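(* Let $k\ge 2$ and let $$\theta_{cr}=\theta_{cr}(k)=\sqrt[k+1]{\frac{(k-1)k^k}{2^k}}.$$ Consider the HC-SOS model on the Cayley tree of order $k$ with spin set $\{0,1,2\}$, wand admissibility graph, and parameter $\theta>0$. Then: 1. If $\theta\ge\theta_{cr}$, there is a unique translation-invariant splitting Gibbs measure (denoted $\mu_0$). 2. If $\theta<\theta_{cr}$, there are exactly three translation-invariant splitting Gibbs measures (denoted $\mu_0,\mu_1,\mu_2$).
   Context: The Cayley tree of order $k$ is the infinite tree in which every vertex has exactly $k+1$ neighbours; $V$ is its vertex set, $x^0\in V$ a fixed root, $W_n$ the set of vertices at distance $n$ from $x^0$, $V_n=\bigcup_{m=0}^n W_m$, and $S(x)$ the set of direct successors of $x$ (the neighbours of $x$ farther from the root). HC-SOS model with $m=2$ (''wand''): spins take values in $\{0,1,2\}$; the wand graph $G$ on $\{0,1,2\}$ has edges $\{0,1\},\{1,2\}$ and loops at $0$ and $2$ (no loop at $1$). A configuration $\sigma$ is admissible if $\{\sigma(x),\sigma(y)\}$ is an edge (or loop) of $G$ for all nearest neighbours $x,y$. The parameter is $\theta=e^J>0$ ($J\in\mathbb R$) and the edge activities are $\lambda_{0,0}=\lambda_{2,2}=1$, $\lambda_{0,1}=\lambda_{1,0}=\lambda_{1,2}=\lambda_{2,1}=\theta$, and $\lambda_{i,j}=0$ otherwise. Given a function $z: x\mapsto z_x=(z_{0,x},z_{1,x},z_{2,x})$ on $V$ with positive entries, normalized by $z_{2,x}=1$, define probability measures on admissible configurations on $V_n$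 by $$\mu_n(\sigma_n)=Z_n^{-1}\prod_{\langle x,y\rangle\subset V_n}\lambda_{\sigma_n(x),\sigma_n(y)}\prod_{x\in W_n}z_{\sigma_n(x),x}.$$ If these are compatible (summing $\mu_n$ over the spins on $W_n$ gives $\mu_{n-1}$), the resulting measure on $\{0,1,2\}^V$ is called a splitting Gibbs measure (SGM). It is translation-invariant if $z_x=(z_0,z_1,1)$ does not depend on $x$. Translation-invariant SGMs correspond to the solutions $x,y>0$, where $z_0=x^k$, $z_1=y^k$, of $$x=\frac{x^k+\theta y^k}{1+\theta y^k},\qquad y=\frac{\theta x^k+\theta}{1+\theta y^k}.$$ The measure $\mu_0$ is the one corresponding to the solution with $x=1$; $\mu_1,\mu_2$ correspond to the solutions with $x\ne 1$. *)

(* Defs.v *)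
(* MathComp / MathComp-Analysis *)
From HB Require Import structures.
From mathcomp Require Import all_boot all_order all_algebra finmap.
From mathcomp Require Import all_classical all_reals all_analysis.

Set Implicit Arguments.
Unset Strict Implicit.
Unset Printing Implicit Defensive.
Import Order.TTheory GRing.Theory Num.Theory.
Local Open Scope classical_set_scope.
Local Open Scope ring_scope.

Definition walk (V : choiceType) (e : rel V) (x y : V) (p : seq V) : Prop :=
  path e x p /\ last x p = y.

Definition is_tree (V : choiceType) (e : rel V) : Prop :=
  [/\ symmetric e, irreflexive e &
      forall x y, exists! p : seq V, walk e x y p /\ uniq (x :: p)].

Definition cayley_tree (k : nat) (V : choiceType) (e : rel V) : Prop :=
  is_tree e /\ forall x, ([set y | e x y] #= `I_k.+1)%card.

Definition at_distance (V : choiceType) (e : rel V) (x y : V) (n : nat) : Prop :=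
  (exists2 p, walk e x y p & size p = n) /\
  (forall q, walk e x y q -> (n <= size q)%N).

Definition sphere (V : choiceType) (e : rel V) (x0 : V) (n : nat) : set V :=
  [set x | at_distance e x0 x n].

(* The spheres of a Cayley tree are finite, so [fset_set] (which sends an
   infinite set to the empty one) loses nothing here. *)
Definition ball_fset (V : choiceType) (e : rel V) (x0 : V) (n : nat) : {fset V} :=
  fset_set (\bigcup_(m in `I_n.+1) sphere e x0 m).

Definition succs (V : choiceType) (e : rel V) (x0 x : V) : set V :=
  [set y | e x y /\ exists n, sphere e x0 n x /\ sphere e x0 n.+1 y].

Notation spin := 'I_3.
Definition s0 : spin := @Ordinal 3 0 isT.
Definition s1 : spin := @Ordinal 3 1 isT.
Definition s2 : spin := @Ordinal 3 2 isT.

HB.instance Definition _ (n : nat) := isPointed.Build 'I_n.+1 ord0.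

Definition wand : rel spin := fun i j =>
  (i, j) \in [:: (s0, s0); (s2, s2); (s0, s1); (s1, s0); (s1, s2); (s2, s1)].

Definition activity (R : realType) (theta : R) (i j : spin) : R :=
  if wand i j then (if i == j then 1 else theta) else 0.

Definition admissible (V : choiceType) (e : rel V) (A : {fset V})
    (s : {ffun A -> spin}) : bool :=
  [forall x, forall y, e (val x) (val y) ==> wand (s x) (s y)].

(* In a rooted tree every edge joins exactly one vertex to one of its direct
   successors, so the double product runs over each edge inside V_n once. *)
Definition weight (R : realType) (V : choiceType) (e : rel V) (x0 : V)
    (theta : R) (z : V -> spin -> R) (n : nat)
    (s : {ffun ball_fset e x0 n -> spin}) : R :=
  (\prod_x \prod_(y | val y \in succs e x0 (val x)) activity theta (s x) (s y))
  * \prod_(x | val x \in sphere e x0 n) z (val x) (s x).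

Definition partition_function (R : realType) (V : choiceType) (e : rel V)
    (x0 : V) (theta : R) (z : V -> spin -> R) (n : nat) : R :=
  \sum_(s : {ffun ball_fset e x0 n -> spin} | admissible e s) weight theta z s.

Definition finite_gibbs (R : realType) (V : choiceType) (e : rel V)
    (x0 : V) (theta : R) (z : V -> spin -> R) (n : nat)
    (s : {ffun ball_fset e x0 n -> spin}) : R :=
  if admissible e s
  then (partition_function e x0 theta z n)^-1 * weight theta z s else 0.

Definition extends (V : choiceType) (A B : {fset V})
    (t : {ffun B -> spin}) (s : {ffun A -> spin}) : bool :=
  [forall x, forall y, (val x == val y) ==> (s x == t y)].

(* The consistency relations are imposed between mu_n.+1 and mu_n for n >= 1,
   i.e. the boundary law is constrained at all vertices but the root. The root
   has k+1 direct successors while every other vertex has k, so the relation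
   between mu_1 and mu_0 would involve (k+1)-st powers and only serves to
   determine the value of z at the root from the other ones; it could not be
   satisfied by a nontrivial constant z. *)
Definition compatible (R : realType) (V : choiceType) (e : rel V) (x0 : V)
    (theta : R) (z : V -> spin -> R) : Prop :=
  forall (n : nat) (s : {ffun ball_fset e x0 n -> spin}), (1 <= n)%N ->
    \sum_(t : {ffun ball_fset e x0 n.+1 -> spin} | extends t s)
      finite_gibbs theta z t
    = finite_gibbs theta z s.

(* {0,1,2}^V with its product sigma-algebra *)
Definition config (V : choiceType) :=
  g_sigma_algebraType
    [set C : set (V -> spin) |
       exists (x : V) (i : spin), C = [set f | f x = i]].

Definition cylinder (V : choiceType) (A : {fset V}) (s : {ffun A -> spin}) :
    set (config V) :=
  [set f | forall x : A, f (val x) = s x].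

Definition splitting_gibbs (R : realType) (V : choiceType) (e : rel V) (x0 : V)
    (theta : R) (z : V -> spin -> R) (mu : probability (config V) R) : Prop :=
  [/\ forall x i, 0 < z x i,
      forall x, z x s2 = 1,
      compatible e x0 theta z &
      forall (n : nat) (s : {ffun ball_fset e x0 n -> spin}), (1 <= n)%N ->
        mu (cylinder s) = (finite_gibbs theta z s)%:E].

Definition TISGM (R : realType) (V : choiceType) (e : rel V) (x0 : V)
    (theta : R) (mu : probability (config V) R) : Prop :=
  exists z : V -> spin -> R,
    (forall x y, z x = z y) /\ splitting_gibbs e x0 theta z mu.

Definition triple (R : realType) (a b c : R) : spin -> R :=
  fun i => nth 0 [:: a; b; c] i.

Definition TI_solution (R : realType) (k : nat) (theta x y : R) : Prop :=
  [/\ 0 < x, 0 < y,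
      x = (x ^+ k + theta * y ^+ k) / (1 + theta * y ^+ k) &
      y = (theta * x ^+ k + theta) / (1 + theta * y ^+ k)].

Definition TISGM_of_solution (R : realType) (k : nat) (V : choiceType)
    (e : rel V) (x0 : V) (theta x y : R) (mu : probability (config V) R) : Prop :=
  TI_solution k theta x y /\
  splitting_gibbs e x0 theta (fun _ => triple (x ^+ k) (y ^+ k) 1) mu.

(* Measures are functions on all subsets whose values on non-measurable sets are
   unconstrained, so Leibniz equality would be too fine. *)
Definition same_measure (R : realType) (V : choiceType)
    (mu nu : probability (config V) R) : Prop :=
  forall A : set (config V), measurable A -> mu A = nu A.

Definition theta_cr (R : realType) (k : nat) : R :=
  ((k%:R - 1) * k%:R ^+ k / 2 ^+ k) `^ (k.+1%:R^-1).

(* Main.v *)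
(* Summing the weights over the spins on the outermost sphere multiplies the
   weight of the inner configuration by [\prod_(x in W_n) transfer (s x) ^+ k],
   so a constant boundary law [z] is compatible exactly when
   [transfer i ^+ k] is proportional to [z i]; necessity is read off the
   configurations that are constant on the first sphere. Hence the constant
   laws are the solutions [(x, y)] of the fixed-point system. A compatible law
   defines a measure: nested partitions of [0, 1[ into intervals of lengths
   [mu_n(s)] turn a uniform random number into a random configuration with the
   prescribed marginals. Cylinders form a pi-system, so the measure is unique,
   and the probabilities of the all-0 and all-2 configurations on the first ball
   recover [x].

   The solutions with [x = 1] reduce to a monotone equation in [y]. For
   [x != 1] the first equation is divisible by [x - 1] and elimination of [y]
   gives [theta ^+ k.+1 = psi x] with
     [psi x = (p x - 1) * p x ^+ k / (1 + x ^+ k) ^+ k],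
     [p x = 1 + x + ... + x ^+ k.-1].
   As [psi] increases strictly on [0, 1] from 0 to [theta_cr ^+ k.+1] and
   [(x, y) |-> (x^-1, y / x)] preserves solutions, there are two solutions with
   [x != 1] below the critical value, and none from it on. *)
Require Import Defs.
From HB Require Import structures.
From mathcomp Require Import all_boot all_order all_algebra finmap.
From mathcomp Require Import all_classical all_reals all_analysis.
From mathcomp Require Import ring lra zify.
Import Order.TTheory GRing.Theory Num.Theory.
Import numFieldNormedType.Exports.
Local Open Scope classical_set_scope.
Local Open Scope ring_scope.

Set Implicit Arguments.
Unset Strict Implicit.
Unset Printing Implicit Defensive.

(** * Solutions of the fixed-point system *)

(** Quotient rule: the derivative of the ratio has the sign of the Wronskian N' D - N D'. Continuity
    up to the endpoints extends strict monotonicity from the open interval to the closed one. *)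
Lemma horner_ratio_lt (R : realType) (N D : {poly R}) (a b : R) :
  {in `[a, b], forall x, 0 < D.[x]} ->
  {in `]a, b[, forall x, 0 < N^`().[x] * D.[x] - N.[x] * D^`().[x]} ->
  {in `[a, b] &, {homo (fun x => N.[x] / D.[x]) : x y / x < y}}.
Proof.
move=> D_gt0 W_gt0.
have df (x : R) : x \in `[a, b] -> is_derive x 1 (fun x => N.[x] / D.[x])
   ((N^`().[x] * D.[x] - N.[x] * D^`().[x]) / D.[x] ^+ 2).
  move=> xab; have Dx0 : D.[x] != 0 by rewrite gt_eqF// D_gt0.
  have dV : is_derive x 1 (fun x => D.[x]^-1) (- D.[x] ^- 2 *: D^`().[x]).
    exact: is_deriveV.
  apply: is_derive_eq (is_deriveM (is_derive_poly N x) dV) _.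
  by rewrite /GRing.scale /=; field.
apply: gtr0_derive1_lt_cc.
- by move=> x /subset_itv_oo_cc /df [].
- move=> x xab; have [_ df'] := df x (subset_itv_oo_cc xab).
  by rewrite derive1E df' divr_gt0 ?exprn_gt0 ?W_gt0// D_gt0 ?subset_itv_oo_cc.
- by apply: derivable_within_continuous => x /df [].
Qed.

(** Pairing x^(m-j) with x^(m+j), AM-GM bounds 1 + x + ... + x^(2m) below by (2m+1) x^m; both sides
    are multiplied by 1 - x. In the induction the previous bound is multiplied by x, and the missing
    term is (1 - x)(1 - x^(m+1))^2. *)
Lemma expr_mid_le (R : realFieldType) (m : nat) (x : R) : 0 < x -> x <= 1 ->
  (2 * m + 1)%:R * x ^+ m * (1 - x) <= 1 - x ^+ (2 * m + 1).
Proof.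
move=> x0 x1; elim: m => [|m IH]; first by rewrite muln0 !expr0 expr1; lra.
have -> : (2 * m.+1 + 1 = (2 * m + 1).+2)%N by rewrite mulnS; ring.
have xm : 0 <= x ^+ (m.+1) by rewrite exprn_ge0 // ltW.
have e2 : x ^+ (2 * m + 1) * x = (x ^+ m.+1) ^+ 2.
  by rewrite -exprSr -exprM; congr (_ ^+ _); lia.
rewrite -[in X in _ <= X]addn2 exprD expr2 mulrA e2.
rewrite -(ler_pM2l x0) in IH.
have e3 : x * (1 - x ^+ (2 * m + 1)) = x - (x ^+ m.+1) ^+ 2 by rewrite -e2; ring.
rewrite e3 in IH.
have {}IH : (2 * m + 1)%:R * x ^+ m.+1 * (1 - x) <= x - (x ^+ m.+1) ^+ 2.
  by move: IH; rewrite (exprS x m); lra.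
have h : 0 <= (1 - x) * (1 - x ^+ m.+1) ^+ 2 by rewrite mulr_ge0 ?sqr_ge0 // subr_ge0.
rewrite -addn2 natrD; move: (x ^+ m.+1) IH h => X; nra.
Qed.

(** This is [p] of the overview. Written as a sum rather than a quotient by 1 - x, it keeps its
    meaning at x = 1, where the critical value is read off. *)
Definition geom (R : realType) (k : nat) : {poly R} := \sum_(i < k) 'X^i.

Lemma horner_geom (R : realType) (k : nat) (x : R) :
  (1 - x) * (geom R k).[x] = 1 - x ^+ k.
Proof.
rewrite -[RHS]opprB subrX1 -mulNr opprB; congr (_ * _).
by rewrite horner_sum; apply: eq_bigr => i _; rewrite hornerXn.
Qed.

Lemma horner_deriv_geom (R : realType) (k : nat) (x : R) :
  (1 - x) * (geom R k)^`().[x] = (geom R k).[x] - k%:R * x ^+ k.-1.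
Proof.
have : (1 - 'X) * geom R k = 1 - 'X^k.
  by rewrite -[RHS]opprB subrX1 -mulNr opprB.
move/(congr1 (fun p => (deriv p).[x])).
rewrite derivM !derivB -polyC1 derivC derivX derivXn !hornerE.
by rewrite hornerMn hornerXn -mulr_natl; lra.
Qed.

Lemma horner_geom_gt0 (R : realType) (k : nat) (x : R) :
  (0 < k)%N -> 0 <= x -> 0 < (geom R k).[x].
Proof.
case: k => // k _ x0; rewrite horner_sum big_ord_recl hornerXn expr0.
rewrite ltr_wpDr// sumr_ge0// => i _.
by rewrite hornerXn exprn_ge0.
Qed.

Definition psi_num (R : realType) (k : nat) : {poly R} :=
  (geom R k - 1) * geom R k ^+ k.
Definition psi_den (R : realType) (k : nat) : {poly R} := (1 + 'X^k) ^+ k.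
Definition psi (R : realType) (k : nat) (x : R) : R :=
  (psi_num R k).[x] / (psi_den R k).[x].

(* The factorisation
     [2 (1 - x)^3 B = F ((1 - x)(1 + Y) + (2k + 2) x (1 - X))
                      + (1 - X)(1 - x)(1 - Y)^2],
   where [X = x^(k-1)], [Y = x^k] and [F] is the difference of the two
   sides of [expr_mid_le], gives the sign of the derivative of [psi]. *)
Lemma psi_wronskian_gt0 (R : realType) (k : nat) (x : R) :
  (2 <= k)%N -> 0 < x < 1 ->
  0 < (psi_num R k)^`().[x] * (psi_den R k).[x]
      - (psi_num R k).[x] * (psi_den R k)^`().[x].
Proof.
case: k => [|k]// k1 /andP[x0 x1].
set p := (geom R k.+1).[x]; set p' := (geom R k.+1)^`().[x].
set X := x ^+ k; set Y := x ^+ k.+1.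
have YE : Y = x * X by rewrite /Y exprS.
have p0 : 0 < p by apply: horner_geom_gt0 => //; exact: ltW.
have Y0 : 0 < Y by rewrite exprn_gt0.
have X1 : X < 1 by rewrite exprn_ilt1 ?ltW// -lt0n; lia.
have Y1 : Y < 1 by rewrite exprn_ilt1 // ltW.
have pE : (1 - x) * p = 1 - Y := horner_geom _ _.
have p'E : (1 - x) * p' = p - k.+1%:R * X := horner_deriv_geom _ _.
(* [B] is the Wronskian stripped of the positive factor p^k (1 + Y)^k. After the case split the
   order of the tree is [k.+1], so here X = x^k. *)
pose B := (p' * p + k.+1%:R * (p - 1) * p') * (1 + Y)
          - k.+1%:R ^+ 2 * X * (p - 1) * p.
have -> : (psi_num R k.+1)^`().[x] * (psi_den R k.+1).[x]
      - (psi_num R k.+1).[x] * (psi_den R k.+1)^`().[x] =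
   p ^+ k * (1 + Y) ^+ k * B.
  rewrite /psi_num /psi_den -polyC1 derivM !deriv_exp derivB derivD derivC derivXn.
  rewrite !hornerE !hornerMn !hornerE -/p -/p' -/X -/Y !exprS /B.
  by rewrite hornerMn hornerXn /= -/X;
    move: (p ^+ k) ((1 + Y) ^+ k) => P Q; clearbody p p' X Y; ring.
have F0 := @expr_mid_le _ k x x0 (ltW x1).
have XX : x ^+ (2 * k + 1) = x * X ^+ 2 by rewrite addn1 exprS mulnC exprM.
rewrite XX -/X in F0.
set F := 1 - x * X ^+ 2 - (2 * k + 1)%:R * X * (1 - x).
have F1 : 0 <= F by rewrite subr_ge0.
have BE : 2 * (1 - x) ^+ 3 * B = F * ((1 - x) * (1 + Y) + (2 * k.+1%:R + 2) * x * (1 - X))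
   + (1 - X) * (1 - x) * (1 - Y) ^+ 2.
  have x10 : 1 - x != 0 by rewrite subr_eq0 gt_eqF.
  have p_def : p = (1 - Y) / (1 - x) by rewrite -pE mulrAC mulfV ?mul1r.
  have p'_def : p' = (p - k.+1%:R * X) / (1 - x) by rewrite -p'E mulrAC mulfV ?mul1r.
  rewrite /B p'_def p_def YE /F (natrD _ (2 * k)) natrM -(natr1 k).
  by move: x10; clear; clearbody X; move: k%:R => kk x10; field.
rewrite pmulr_rgt0; last by rewrite mulr_gt0 ?exprn_gt0 ?addr_gt0.
have x1' : 0 < 1 - x by rewrite subr_gt0.
have c0 : 0 < 2 * (1 - x) ^+ 3 by rewrite mulr_gt0 ?exprn_gt0.
rewrite -(pmulr_rgt0 B c0). rewrite BE ltr_wpDl//.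
  rewrite mulr_ge0// addr_ge0//; first by rewrite mulr_ge0 ?ltW// addr_gt0.
  apply: mulr_ge0; last by rewrite subr_ge0 ltW.
  by rewrite mulr_ge0 ?(ltW x0)// addr_ge0// mulr_ge0.
by rewrite !mulr_gt0 ?exprn_gt0 ?subr_gt0.
Qed.

Lemma psi_lt (R : realType) (k : nat) : (2 <= k)%N ->
  {in `[0, 1] &, {homo @psi R k : x y / x < y}}.
Proof.
move=> k2; apply: horner_ratio_lt => x; rewrite in_itv/= => /andP[x0 x1].
  by rewrite !hornerE exprn_gt0// ltr_pwDl// exprn_ge0.
by apply: psi_wronskian_gt0 => //; apply/andP.
Qed.

Lemma psi0 (R : realType) (k : nat) : (0 < k)%N -> psi k (0 : R) = 0.
Proof.
move=> k0; have := @horner_geom R k 0; rewrite expr0n gtn_eqF// subr0 mul1r => g.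
by rewrite /psi /psi_num !hornerE g subrr !mul0r.
Qed.

Lemma psi1 (R : realType) (k : nat) :
  psi k (1 : R) = (k%:R - 1) * k%:R ^+ k / 2 ^+ k.
Proof.
have g : (geom R k).[1] = k%:R.
  rewrite horner_sum (eq_bigr (fun=> 1)) => [|i _]; last by rewrite hornerXn expr1n.
  by rewrite sumr_const card_ord.
by rewrite /psi /psi_num /psi_den !hornerE g expr1n.
Qed.

Lemma psi_continuous (R : realType) (k : nat) (x : R) :
  0 <= x -> {for x, continuous (@psi R k)}.
Proof.
move=> x0; apply: continuousM; first exact: continuous_horner.
apply: continuousV; last exact: continuous_horner.
by rewrite gt_eqF// !hornerE exprn_gt0// ltr_pwDl// exprn_ge0.
Qed.

Lemma theta_cr_exp (R : realType) (k : nat) :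
  (0 < k)%N -> theta_cr R k ^+ k.+1 = psi k 1.
Proof.
move=> k0; rewrite psi1 /theta_cr -powR_mulrn ?powR_ge0// -powRrM.
rewrite mulVf ?pnatr_eq0// powRr1// divr_ge0 ?mulr_ge0 ?exprn_ge0//.
by rewrite subr_ge0 ler1n.
Qed.

Lemma theta_lt_cr (R : realType) (k : nat) (theta : R) :
  (0 < k)%N -> 0 < theta ->
  (theta < theta_cr R k) = (theta ^+ k.+1 < psi k 1).
Proof.
by move=> k0 t0; rewrite -theta_cr_exp// ltr_pXn2r// nnegrE ?powR_ge0// ltW.
Qed.

(** * Counting the solutions with x = 1 and with x != 1 *)

Section TI_solutions.
Variables (R : realType) (k : nat) (theta : R).
Hypotheses (k2 : (2 <= k)%N) (theta_gt0 : 0 < theta).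

(** Exchanging spins 0 and 2 preserves the model. It turns the law (z0, z1, 1) into (1, z1, z0),
    which normalizes to (1/z0, z1/z0, 1); k-th roots give the stated pair. *)
Lemma TI_solutionV (x y : R) :
  TI_solution k theta x y -> TI_solution k theta x^-1 (y / x).
Proof.
case=> x0 y0 xE yE; have xk := exprn_gt0 k x0; have yk := exprn_gt0 k y0.
have d0 : 0 < 1 + theta * y ^+ k by rewrite addr_gt0 ?mulr_gt0.
have n0 : 0 < x ^+ k + theta * y ^+ k by rewrite addr_gt0 ?mulr_gt0.
split; rewrite ?invr_gt0 ?divr_gt0// ?expr_div_n ?exprVn.
  rewrite [in LHS]xE; field.
  by rewrite !gt_eqF.
have -> : y / x = (theta * x ^+ k + theta) / (1 + theta * y ^+ k) /
    ((x ^+ k + theta * y ^+ k) / (1 + theta * y ^+ k)) by rewrite -xE -yE.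
field.
by rewrite !gt_eqF.
Qed.

(** The first equation rearranges to (1 - x)(1 + theta y^k) = 1 - x^k, so the common denominator
    equals p. The second equation then gives y, and inserting it into theta y^k = p - 1 eliminates
    y. *)
Lemma TI_solution_psi (x y : R) : 0 < x < 1 ->
  TI_solution k theta x y ->
  theta ^+ k.+1 = psi k x /\ y = theta * (x ^+ k + 1) / (geom R k).[x].
Proof.
move=> /andP[x0 x1] [_ y0 xE yE]; set p := (geom R k).[x].
have p0 : 0 < p by rewrite horner_geom_gt0 ?ltW// (ltnW k2).
have xk := exprn_gt0 k x0; have yk := exprn_gt0 k y0.
have d0 : 0 < 1 + theta * y ^+ k by rewrite addr_gt0 ?mulr_gt0.
have pE : (1 - x) * p = 1 - x ^+ k := horner_geom _ _.
have x10 : 1 - x != 0 by rewrite subr_eq0 gt_eqF.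
have eqp : 1 + theta * y ^+ k = p.
  apply: (mulfI x10); rewrite pE.
  have : x * (1 + theta * y ^+ k) = x ^+ k + theta * y ^+ k.
    by rewrite [in LHS]xE mulfVK ?gt_eqF.
  by lra.
have yE' : y = theta * (x ^+ k + 1) / p by rewrite yE eqp mulrDr mulr1.
split=> //; have : p - 1 = theta ^+ k.+1 * (x ^+ k + 1) ^+ k / p ^+ k.
  rewrite exprS -!mulrA [_ ^+ k * (_ / _)]mulrA -exprMn -expr_div_n.
  by rewrite -yE' -eqp addrC addKr.
rewrite /psi /psi_num /psi_den !hornerE -/p.
move=> ->; rewrite addrC; field.
by rewrite !expf_neq0// gt_eqF// addr_gt0.
Qed.

Lemma psi_TI_solution (x : R) : 0 < x < 1 -> theta ^+ k.+1 = psi k x ->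
  TI_solution k theta x (theta * (x ^+ k + 1) / (geom R k).[x]).
Proof.
move=> /andP[x0 x1] tE; set p := (geom R k).[x].
have p0 : 0 < p by rewrite horner_geom_gt0 ?ltW// (ltnW k2).
have xk := exprn_gt0 k x0.
have x10 : 1 - x != 0 by rewrite subr_eq0 gt_eqF.
have pE : (1 - x) * p = 1 - x ^+ k := horner_geom _ _.
set y := _ / p.
have yk : theta * y ^+ k = p - 1.
  have -> : theta * y ^+ k = theta ^+ k.+1 * (x ^+ k + 1) ^+ k / p ^+ k.
    by rewrite /y expr_div_n exprMn exprS !mulrA.
  rewrite tE /psi /psi_num /psi_den !hornerE -/p.
  rewrite [1 + _]addrC; field.
  by rewrite !expf_neq0// gt_eqF// addr_gt0.
split; rewrite // ?yk.
- by rewrite divr_gt0// mulr_gt0// addr_gt0.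
- rewrite [1 + _]addrC subrK; apply: (mulIf (lt0r_neq0 p0)); rewrite mulfVK ?gt_eqF//.
  by lra.
- by rewrite [1 + _]addrC subrK /y mulrDr mulr1.
Qed.

(** For x = 1 the first equation is an identity and the second reads theta y^(k+1) + y = 2 theta.
    The difference of its two sides changes sign between 0 and 2 theta. *)
Lemma TI_solution1_exists : exists y : R, TI_solution k theta 1 y.
Proof.
pose f := horner (theta *: 'X^(k.+1) + 'X - (2 * theta)%:P).
have fE y : f y = theta * y ^+ k.+1 + y - 2 * theta by rewrite /f !hornerE.
have f0 : f 0 = - (2 * theta) by rewrite fE expr0n/= mulr0 !add0r.
have f2 : 0 < f (2 * theta).
  by rewrite fE addrK mulr_gt0 ?exprn_gt0 ?mulr_gt0.
have [|||y yI fy0] := @IVT R f 0 (2 * theta) 0.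
- by rewrite mulr_ge0 ?ltW.
- exact/continuous_subspaceT/continuous_horner.
- by rewrite f0 ge_min le_max oppr_le0 (ltW f2) orbT mulr_ge0// ltW.
have y0 : 0 < y.
  rewrite lt_neqAle; move: yI; rewrite in_itv/= => /andP[-> _]; rewrite andbT.
  apply/eqP => ye; move: fy0; rewrite -ye f0 => /eqP.
  by rewrite oppr_eq0 mulf_eq0 gt_eqF//= gt_eqF.
have d0 : 0 < 1 + theta * y ^+ k by rewrite addr_gt0 ?mulr_gt0 ?exprn_gt0.
exists y; split; rewrite ?expr1n ?divff ?gt_eqF//.
apply: (mulIf (lt0r_neq0 d0)); rewrite mulfVK ?gt_eqF//.
by move: fy0; rewrite fE exprS; lra.
Qed.

Lemma TI_solution1_unique (y y' : R) :
  TI_solution k theta 1 y -> TI_solution k theta 1 y' -> y = y'.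
Proof.
have E z : TI_solution k theta 1 z -> 0 < z /\ theta * z ^+ k.+1 + z = 2 * theta.
  case=> _ z0 _ zE; split=> //.
  have d0 : 0 < 1 + theta * z ^+ k by rewrite addr_gt0 ?mulr_gt0 ?exprn_gt0.
  move/(congr1 (fun t => t * (1 + theta * z ^+ k))): zE.
  by rewrite mulfVK ?gt_eqF// expr1n exprS; lra.
(* The left side of the equation is strictly increasing on positive arguments. *)
have lt z z' : 0 < z -> 0 < z' -> z < z' ->
    theta * z ^+ k.+1 + z < theta * z' ^+ k.+1 + z'.
  by move=> z0 z0' zz'; rewrite ltrD// ltr_pM2l// ltr_pXn2r// nnegrE ltW.
move=> /E[y0 yE] /E[y0' yE']; case: (ltgtP y y') => // h.
  by have := lt _ _ y0 y0' h; rewrite yE yE' ltxx.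
by have := lt _ _ y0' y0 h; rewrite yE yE' ltxx.
Qed.

Lemma TI_solution_lt1 (x y : R) : x < 1 ->
  TI_solution k theta x y -> theta < theta_cr R k.
Proof.
move=> x1 s; have x0 : 0 < x by case: s.
have x01 : 0 < x < 1 by apply/andP.
have [tE _] := TI_solution_psi x01 s.
rewrite theta_lt_cr ?(ltnW k2)// tE; apply: psi_lt => //.
  by rewrite in_itv/= !ltW.
by rewrite in_itv/= ler01 lexx.
Qed.

Lemma TI_solution_ge_cr (x y : R) : theta_cr R k <= theta ->
  TI_solution k theta x y -> x = 1.
Proof.
rewrite leNgt => /negP ncr s; case: (ltgtP x 1) => // x1; exfalso; apply: ncr.
  exact: TI_solution_lt1 s.
by apply: TI_solution_lt1 (TI_solutionV s); rewrite invf_lt1// (lt_trans _ x1).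
Qed.

Lemma TI_solution_lt_cr : theta < theta_cr R k ->
  exists x y : R, [/\ x < 1, TI_solution k theta x y &
    forall x' y', TI_solution k theta x' y' ->
      [\/ x' = 1, x' = x /\ y' = y | x' = x^-1 /\ y' = y / x]].
Proof.
have k0 := ltnW k2; rewrite theta_lt_cr// => tlt.
have [|||x xI xE] := @IVT R (psi k) 0 1 (theta ^+ k.+1); first exact: ler01.
- apply: continuous_in_subspaceT => z; rewrite inE/= in_itv/= => /andP[z0 _].
  exact: psi_continuous.
- by rewrite psi0// ge_min le_max (ltW tlt) orbT exprn_ge0 ?(ltW theta_gt0).
(* The endpoints are excluded because psi 0 = 0 < theta^(k+1) < psi 1. *)
have x01 : 0 < x < 1.
  move: xI; rewrite in_itv/= !le_eqVlt => /andP[/predU1P[x0|->]] /=.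
    by move: xE; rewrite -x0 psi0// => /eqP; rewrite lt_eqF// exprn_gt0.
  by move=> /predU1P[x1|->//]; move: tlt; rewrite -xE x1 ltxx.
have /andP[x0 x1] := x01.
have s := psi_TI_solution x01 (esym xE).
have unq x' y' : x' < 1 -> TI_solution k theta x' y' ->
    x' = x /\ y' = theta * (x ^+ k + 1) / (geom R k).[x].
  move=> x'1 s'; have x'0 : 0 < x' by case: s'.
  have [|tE ->] := TI_solution_psi _ s'; first by apply/andP.
  suff -> : x' = x by [].
  have I (z : R) : 0 < z -> z < 1 -> z \in `[0, 1] by move=> *; rewrite in_itv/= !ltW.
  case: (ltgtP x' x) => // h.
    by have := psi_lt k2 (I _ x'0 x'1) (I _ x0 x1) h; rewrite -tE xE ltxx.
  by have := psi_lt k2 (I _ x0 x1) (I _ x'0 x'1) h; rewrite -tE xE ltxx.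
eexists; eexists; split; [exact: x1|exact: s|] => x' y' s'.
case: (ltgtP x' 1) => [h|h|->]; last by constructor 1.
  by constructor 2; apply: unq.
have [|xV yV] := unq _ _ _ (TI_solutionV s').
  by rewrite invf_lt1// (lt_trans _ h).
have x'E : x' = x^-1 by rewrite -xV invrK.
constructor 3; split=> //.
by rewrite -yV -xV invrK mulfVK// gt_eqF// (lt_trans _ h).
Qed.

End TI_solutions.

(** * Spheres and successors in a rooted tree *)

Section RootedTree.
Variables (k : nat) (V : choiceType) (e : rel V) (x0 : V).
Hypothesis hV : cayley_tree k e.

(** The list omits its starting vertex [x0]. In a tree the path exists, so the default [[::]] of
    [xget] never intervenes. *)
Definition root_path (x : V) : seq V :=
  xget [::] [set p | walk e x0 x p /\ uniq (x0 :: p)].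

Definition depth (x : V) : nat := size (root_path x).

(** The last vertex but one of the path from the root. At depth 1 the truncated list is empty and
    [last] rightly returns [x0]; the root is its own parent by convention. *)
Definition parent (x : V) : V := last x0 (take (depth x).-1 (root_path x)).

Lemma root_path_spec (x : V) :
  [/\ path e x0 (root_path x), last x0 (root_path x) = x &
      uniq (x0 :: root_path x)].
Proof.
have [[_ _ /(_ x0 x)[p [hp _]]] _] := hV.
by have /= [[]] := @xgetI _ [::] [set p | walk e x0 x p /\ uniq (x0 :: p)] p hp.
Qed.

Lemma root_pathP (x : V) (p : seq V) :
  path e x0 p -> last x0 p = x -> uniq (x0 :: p) -> root_path x = p.
Proof.
move=> h1 h2 h3; have [[_ _ /(_ x0 x)[q [_ uq]]] _] := hV.
have [g1 g2 g3] := root_path_spec x.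
by rewrite -(uq p)// -(uq (root_path x)).
Qed.

(** A walk shortens to a simple path, which by uniqueness is [root_path x]. *)
Lemma depth_le (x : V) (q : seq V) : walk e x0 x q -> (depth x <= size q)%N.
Proof.
move=> [hq lq]; move: lq; case/shortenP: hq => p hp up sub lp.
rewrite /depth (root_pathP hp lp up); move: up => /= /andP[_ up].
exact: uniq_leq_size.
Qed.

Lemma sphereE (n : nat) : sphere e x0 n = [set x | depth x = n].
Proof.
apply/seteqP; split=> x /=.
  move=> [[p hp sp] mp]; apply/eqP; rewrite eqn_leq -{1}sp depth_le// mp//.
  by have [h1 h2 _] := root_path_spec x.
move=> <-; split=> [|q]; last exact: depth_le.
by exists (root_path x) => //; have [h1 h2 _] := root_path_spec x.
Qed.

Lemma root_path0 : root_path x0 = [::].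
Proof. exact: root_pathP. Qed.

Lemma depth_eq0 (x : V) : (depth x == 0) = (x == x0).
Proof.
apply/idP/eqP => [/nilP d|->]; last by rewrite /depth root_path0.
by have [_ <- _] := root_path_spec x; rewrite d.
Qed.

Lemma depth_root : depth x0 = 0%N.
Proof. by rewrite /depth root_path0. Qed.

(** If y is off the path to x, appending y gives the simple path to y. Otherwise the path is cut at
    y, and its tail from y to x must be the single edge, by uniqueness of simple paths. *)
Lemma root_path_edge (x y : V) : e x y ->
  root_path y = rcons (root_path x) y \/ root_path x = rcons (root_path y) x.
Proof.
move=> exy; have [[se ie ut] _] := hV.
have [h1 h2 h3] := root_path_spec x.
have [yp|yp] := boolP (y \in x0 :: root_path x); last first.
  left; apply: root_pathP; first by rewrite rcons_path h1 h2.
    by rewrite last_rcons.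
  by rewrite -rcons_cons rcons_uniq yp.
right; move: h2 h1 h3; case/splitPl: yp => p1 p2 l1; rewrite last_cat l1.
rewrite cat_path l1 => l2 /andP[h1 h2] h3.
have /andP[u1 u2] : uniq (x0 :: p1) && uniq (y :: p2).
  move: h3; rewrite -cat_cons cat_uniq => /and3P[-> /hasPn h u2] /=; rewrite u2 andbT.
  by apply/negP => /h; rewrite -l1 mem_last.
rewrite (root_pathP h1 l1 u1).
have [q [_ uq]] := ut y x; rewrite -cats1; congr (_ ++ _).
rewrite -(uq p2)// (uq [:: x])//; split; first by split=> //=; rewrite se exy.
by rewrite /= inE andbT; apply: contraTneq exy => ->; rewrite ie.
Qed.

Lemma root_path_rcons (x y : V) : root_path y = rcons (root_path x) y ->
  [/\ e x y, depth y = (depth x).+1 & parent y = x].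
Proof.
move=> yE; have [+ _ _] := root_path_spec y; have [_ h2 _] := root_path_spec x.
rewrite yE rcons_path h2 => /andP[_ exy].
have dE : depth y = (depth x).+1 by rewrite /depth yE size_rcons.
by split=> //; rewrite /parent dE /= yE -cats1 take_size_cat.
Qed.

Lemma parent_spec (y : V) : y != x0 -> root_path y = rcons (root_path (parent y)) y.
Proof.
move=> yx0; have [h1 h2 h3] := root_path_spec y; rewrite /parent /depth.
case/lastP: (root_path y) h1 h2 h3 => [|p z].
  by move=> _ /= yE; rewrite yE eqxx in yx0.
rewrite rcons_path last_rcons size_rcons => /andP[h1 _] -> h3.
rewrite -cats1 take_size_cat// (@root_pathP _ p)// ?cats1//.
by move: h3; rewrite -rcons_cons rcons_uniq => /andP[].
Qed.

(** Turns the metric definition of successors into the graph of a function, so that edges can be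
    indexed by their lower endpoint. *)
Lemma succsE (x y : V) : succs e x0 x y <-> y != x0 /\ parent y = x.
Proof.
rewrite /succs; split=> [/= [exy [n]]|[yx0 <-]] /=.
  rewrite sphereE sphereE /= => -[dx dy].
  have [/root_path_rcons[_ _ ->]|/root_path_rcons[_ dE _]] := root_path_edge exy.
    by rewrite -depth_eq0 dy.
  lia.
have [exy dE _] := root_path_rcons (parent_spec yx0).
by split=> //; exists (depth (parent y)); rewrite !sphereE.
Qed.

Lemma edgeE (x y : V) : e x y <->
  (y != x0 /\ parent y = x) \/ (x != x0 /\ parent x = y).
Proof.
split=> [exy|[]].
- have [/root_path_rcons[_ d p]|/root_path_rcons[_ d p]] := root_path_edge exy.
    by left; rewrite -depth_eq0 d.
  by right; rewrite -depth_eq0 d.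
- by move=> [yx0 <-]; have [] := root_path_rcons (parent_spec yx0).
- move=> [xx0 <-]; have [[se _ _] _] := hV.
  by rewrite se; have [] := root_path_rcons (parent_spec xx0).
Qed.

Lemma depth_parent (x : V) : x != x0 -> depth x = (depth (parent x)).+1.
Proof. by move=> xx0; have [] := root_path_rcons (parent_spec xx0). Qed.

(** By induction: the next sphere lies in a finite union of finite neighbourhoods. *)
Lemma finite_sphere (n : nat) : finite_set (sphere e x0 n).
Proof.
elim: n => [|n IH].
  apply: (@sub_finite_set _ _ [set x0]); last exact: finite_set1.
  by rewrite sphereE => x /= /eqP; rewrite depth_eq0 => /eqP.
apply: (@sub_finite_set _ _ (\bigcup_(x in sphere e x0 n) [set y | e x y])).
  rewrite !sphereE => y /= dy.
  have yx0 : y != x0 by rewrite -depth_eq0 dy.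
  have [exy dE _] := root_path_rcons (parent_spec yx0).
  by exists (parent y) => //=; move: dE; rewrite dy => -[].
apply: bigcup_finite => // x _; have [_ /(_ x) c] := hV.
by apply/finite_setP; exists k.+1.
Qed.

Lemma in_ball (n : nat) (x : V) : (x \in ball_fset e x0 n) = (depth x <= n)%N.
Proof.
rewrite /ball_fset in_fset_set; last first.
  by apply: bigcup_finite => // m _; exact: finite_sphere.
apply/idP/idP; rewrite inE /=; first move=> [m /= mn].
  by rewrite sphereE /= => ->; rewrite -ltnS.
by move=> h; exists (depth x); rewrite ?sphereE//= ltnS.
Qed.

Lemma sub_ball (n : nat) : {subset ball_fset e x0 n <= ball_fset e x0 n.+1}.
Proof. by move=> x; rewrite !in_ball => /leqW. Qed.

(** Among the k + 1 neighbours of a vertex other than the root, exactly one is its parent. *)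
Lemma card_succs (x : V) : x != x0 ->
  finite_set (succs e x0 x) /\ #|` fset_set (succs e x0 x)| = k.
Proof.
move=> xx0; have [[se ie _] /(_ x) c] := hV.
have fN : finite_set [set y | e x y] by apply/finite_setP; exists k.+1.
have sE : succs e x0 x = [set y | e x y] `\ parent x.
  apply/seteqP; split=> y /=.
    move/succsE => [yx0 px]; split; first by apply/edgeE; left.
    move=> yE; have := depth_parent yx0; have := depth_parent xx0.
    by rewrite px yE; lia.
  by move=> [/edgeE[[yx0 px]|[_ ->]] //] _; exact/succsE.
split; first by rewrite sE; exact: finite_setD.
rewrite sE fset_setD1//.
have pN : parent x \in fset_set [set y | e x y].
  by rewrite in_fset_set// inE /=; apply/edgeE; right.
have := cardfsD1 (parent x) (fset_set [set y | e x y]).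
by rewrite pN (card_fset_set c) => -[].
Qed.

End RootedTree.

(** * Finite-volume weights *)

(** Totalizing a configuration, with the arbitrary value [s0] outside its domain, allows
    configurations on different balls to be compared at a vertex without casts. *)
Definition ext_conf (V : choiceType) (A : {fset V}) (s : {ffun A -> spin})
  (x : V) : spin := if insub x is Some u then s u else s0.

Lemma ext_confE (V : choiceType) (A : {fset V}) (s : {ffun A -> spin}) (u : A) :
  ext_conf s (val u) = s u.
Proof. by rewrite /ext_conf valK. Qed.

Definition restr_conf (V : choiceType) (A B : {fset V}) (t : {ffun B -> spin}) :
  {ffun A -> spin} := [ffun x => ext_conf t (val x)].

Lemma restr_ext (V : choiceType) (A B : {fset V}) (t : {ffun B -> spin}) (x : V) :
  x \in A -> ext_conf (restr_conf A t) x = ext_conf t x.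
Proof. by move=> xA; rewrite (ext_confE _ [` xA]%fset) ffunE. Qed.

Lemma extendsE (V : choiceType) (A B : {fset V}) (t : {ffun B -> spin})
  (s : {ffun A -> spin}) : {subset A <= B} ->
  extends t s = (restr_conf A t == s).
Proof.
move=> AB; apply/forallP/eqP => [h|<- x].
  apply/ffunP => x; rewrite ffunE; apply/esym.
  have /forallP/(_ [` AB _ (valP x)]%fset)/implyP/(_ (eqxx _))/eqP -> := h x.
  by rewrite -ext_confE.
by apply/forallP => y; apply/implyP => /eqP xy; rewrite ffunE xy ext_confE.
Qed.

(** Extending a given configuration is a condition on each coordinate separately, the form in which
    a sum of products distributes into a product of sums. *)
Lemma restr_family (V : choiceType) (A B : {fset V}) (t : {ffun B -> spin})
  (s : {ffun A -> spin}) : {subset A <= B} ->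
  (restr_conf A t == s) =
  (t \in family (fun y : B => [pred j | (val y \in A) ==> (j == ext_conf s (val y))])).
Proof.
move=> AB; apply/eqP/familyP => [<- y|h].
  by rewrite inE; apply/implyP => yA; rewrite restr_ext// ext_confE.
apply/ffunP => x; rewrite ffunE.
have := h [` AB _ (valP x)]%fset; rewrite inE /= (valP x) /= => /eqP.
by rewrite ext_confE -ext_confE.
Qed.

Lemma sum_spin (R : nmodType) (F : spin -> R) :
  \sum_j F j = F s0 + F s1 + F s2.
Proof.
rewrite !big_ord_recl big_ord0 addr0 addrA.
by congr (F _ + F _ + F _); apply: val_inj.
Qed.

Lemma spinP (P : spin -> Prop) : P s0 -> P s1 -> P s2 -> forall i, P i.
Proof.
move=> p0 p1 p2 [[|[|[|//]]] h].
- by rewrite (_ : Ordinal h = s0)//; apply: val_inj.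
- by rewrite (_ : Ordinal h = s1)//; apply: val_inj.
- by rewrite (_ : Ordinal h = s2)//; apply: val_inj.
Qed.

Lemma wandC : symmetric wand.
Proof. by elim/spinP; elim/spinP. Qed.

Lemma big_fset_sub (R : comNzRingType) (V : choiceType) (A B : {fset V}) (F : V -> R) :
  {subset A <= B} ->
  \prod_(y : B | val y \in A) F (val y) = \prod_(y : A) F (val y).
Proof.
move=> AB; transitivity (\prod_(y <- B | y \in A) F y).
  by rewrite [RHS]big_seq_fsetE.
rewrite big_fset_condE; transitivity (\prod_(y <- A) F y).
  2: by rewrite big_seq_fsetE.
 suff -> : [fset i in B | i \in A]%fset = A by [].
apply/fsetP => y; rewrite !inE /=; apply/andP/idP => [[]|yA] //.
by split=> //; exact: AB.
Qed.

Section Weights.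
Variables (R : realType) (k : nat) (V : choiceType) (e : rel V) (x0 : V).
Hypothesis hV : cayley_tree k e.
Variable (theta : R).
Hypothesis theta_gt0 : 0 < theta.
Local Notation B := (ball_fset e x0).
Local Notation depth := (depth e x0).
Local Notation parent := (parent e x0).
Local Notation act := (activity theta).

Lemma activity_ge0 (i j : spin) : 0 <= act i j.
Proof. by rewrite /activity; case: ifP => // _; case: ifP => // _; exact: ltW. Qed.

(** Each edge is counted once, at its endpoint farther from the root. *)
Definition edge_weight (n : nat) (s : {ffun B n -> spin}) : R :=
  \prod_(y : B n | val y != x0) act (ext_conf s (parent (val y))) (s y).

Lemma weightE (z : V -> spin -> R) (n : nat) (s : {ffun B n -> spin}) :
  weight theta z s =
  edge_weight s * \prod_(x : B n | depth (val x) == n) z (val x) (s x).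
Proof.
rewrite /weight; congr (_ * _); last first.
  by apply: eq_bigl => x; rewrite (sphereE x0 hV); apply/idP/eqP; rewrite inE.
(* After the exchange, the inner product over x contains only the parent of y. *)
rewrite (exchange_big_dep (fun y : B n => val y != x0)) /=; last first.
  by move=> x y _; rewrite inE => /(succsE x0 hV)[].
apply: eq_bigr => y yx0.
have pB : parent (val y) \in B n.
  move: (valP y); rewrite !(in_ball x0 hV) (depth_parent hV yx0); exact: ltnW.
rewrite (big_pred1 [` pB]%fset) => [|x]; first by rewrite -[s [` pB]%fset]ext_confE.
rewrite /= -val_eqE /=; apply/idP/eqP; rewrite inE.
  by move/(succsE x0 hV) => [].
by move=> ->; apply/(succsE x0 hV).
Qed.

Lemma edge_weight_ge0 (n : nat) (s : {ffun B n -> spin}) : 0 <= edge_weight s.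
Proof. by apply: prodr_ge0 => y _; exact: activity_ge0. Qed.

(** A forbidden pair on an edge contributes activity 0; the symmetry of [wand] covers both
    orientations of the edge. *)
Lemma edge_weight_nonadmissible (n : nat) (s : {ffun B n -> spin}) :
  ~~ admissible e s -> edge_weight s = 0.
Proof.
have H (x y : B n) : val y != x0 -> parent (val y) = val x ->
    ~~ wand (s x) (s y) -> edge_weight s = 0.
  move=> yx0 py /negbTE w; rewrite /edge_weight (bigD1 y)//= py ext_confE.
  by rewrite /activity w mul0r.
move=> /forallPn[x /forallPn[y]]; rewrite negb_imply => /andP[exy w].
have [[yx0 py]|[xx0 px]] := (edgeE x0 hV _ _).1 exy; first exact: H py w.
by apply: H px _ => //; rewrite wandC.
Qed.

Lemma finite_gibbsE (z : V -> spin -> R) (n : nat) (s : {ffun B n -> spin}) :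
  finite_gibbs theta z s = (partition_function e x0 theta z n)^-1 * weight theta z s.
Proof.
rewrite /finite_gibbs; case: ifPn => // /edge_weight_nonadmissible E.
by rewrite weightE E mul0r mulr0.
Qed.

Lemma partition_functionE (z : V -> spin -> R) (n : nat) :
  partition_function e x0 theta z n = \sum_(s : {ffun B n -> spin}) weight theta z s.
Proof.
rewrite /partition_function big_mkcond; apply: eq_bigr => s _.
by case: ifPn => // /edge_weight_nonadmissible E; rewrite weightE E mul0r.
Qed.

Lemma partition_function_gt0 (z : V -> spin -> R) (n : nat) :
  (forall x i, 0 < z x i) -> 0 < partition_function e x0 theta z n.
Proof.
(* The all-0 configuration has positive weight, since there is a loop at 0. *)
move=> z0; rewrite partition_functionE (bigD1 [ffun=> s0])//=.
rewrite ltr_wpDr//.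
  apply: sumr_ge0 => s _; rewrite weightE mulr_ge0 ?edge_weight_ge0//.
  by apply: prodr_ge0 => x _; exact: ltW.
rewrite weightE mulr_gt0//; last exact: prodr_gt0.
apply: prodr_gt0 => y _; rewrite ffunE /ext_conf.
by case: insubP => [u _ _|_]; rewrite ?ffunE.
Qed.

Lemma restr_split (n : nat) (F : {ffun B n.+1 -> spin} -> R) :
  \sum_t F t = \sum_(s : {ffun B n -> spin}) \sum_(t | extends t s) F t.
Proof.
rewrite (partition_big (@restr_conf V (B n) (B n.+1)) predT)//=.
apply: eq_bigr => s _; apply: eq_bigl => t; rewrite extendsE//.
exact: (@sub_ball _ _ _ _ hV n).
Qed.

Lemma sum_finite_gibbs (z : V -> spin -> R) (n : nat) : (forall x i, 0 < z x i) ->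
  \sum_(s : {ffun B n -> spin}) finite_gibbs theta z s = 1.
Proof.
move=> z0; under eq_bigr do rewrite finite_gibbsE.
by rewrite -big_distrr -partition_functionE /= mulVf// gt_eqF// partition_function_gt0.
Qed.

Lemma finite_gibbs_ge0 (z : V -> spin -> R) (n : nat) (s : {ffun B n -> spin}) :
  (forall x i, 0 < z x i) -> 0 <= finite_gibbs theta z s.
Proof.
move=> z0; rewrite finite_gibbsE mulr_ge0 ?invr_ge0 ?(ltW (partition_function_gt0 _ _))//.
by rewrite weightE mulr_ge0 ?edge_weight_ge0// prodr_ge0// => x _; exact: ltW.
Qed.

(** * Compatibility of constant boundary laws *)

Section Constant.
Variable zc : spin -> R.
Let z := fun _ : V => zc.

(** What one outer vertex contributes, once its spin is summed out, to a parent of spin [i]. *)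
Definition transfer (i : spin) : R := \sum_j act i j * zc j.

(** The sum factorizes over vertices. Inner vertices are frozen and give the edge weight; outer ones
    each give a [transfer], and grouping them by parent yields k-th powers, because for n >= 1 the
    parents are not the root. *)
Lemma sum_extensions (n : nat) (s : {ffun B n -> spin}) : (1 <= n)%N ->
  \sum_(t : {ffun B n.+1 -> spin} | extends t s) weight theta z t =
  edge_weight s * \prod_(x : B n | depth (val x) == n) transfer (s x) ^+ k.
Proof.
move=> n1; have sub : {subset B n <= B n.+1} := @sub_ball _ _ _ x0 hV n.
(* Local factor of y: its edge to the parent and, on the outermost sphere, the boundary law. *)
pose H (y : B n.+1) j :=
  (if val y != x0 then act (ext_conf s (parent (val y))) j else 1) *
  (if depth (val y) == n.+1 then zc j else 1).
transitivity (\sum_(t in family (fun y : B n.+1 =>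
    [pred j | (val y \in B n) ==> (j == ext_conf s (val y))])) \prod_y H y (t y)).
  apply: eq_big => [t|t]; first by rewrite extendsE// restr_family.
  rewrite extendsE// => /eqP ts; rewrite weightE /H big_split /= -!big_mkcond /=.
  congr (_ * _); apply: eq_bigr => y yx0; congr (act _ _).
  rewrite -ts restr_ext// (in_ball x0 hV).
  by move: (valP y); rewrite (in_ball x0 hV) (depth_parent hV yx0).
rewrite -bigA_distr_big_dep /= (bigID (fun y : B n.+1 => val y \in B n)) /=.
congr (_ * _).
  pose F v := if v != x0 then act (ext_conf s (parent v)) (ext_conf s v) else 1.
  transitivity (\prod_(y : B n.+1 | val y \in B n) F (val y)).
    apply: eq_bigr => y yB; rewrite (big_pred1 (ext_conf s (val y))); last first.
      by move=> j; rewrite yB.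
    move: yB; rewrite /H /F (in_ball x0 hV) => yB.
    by rewrite ltn_eqF ?mulr1.
  rewrite big_fset_sub// /edge_weight [RHS]big_mkcond /=.
  by apply: eq_bigr => y _; rewrite /F ext_confE.
have rootB : x0 \in B n by rewrite (in_ball x0 hV) (depth_root x0 hV).
(* The parent as an element of the smaller ball; the default is never reached on outer vertices, as
   [out] shows. *)
pose p (y : B n.+1) : B n := odflt [` rootB]%fset (insub (parent (val y))).
have out (y : B n.+1) : val y \notin B n -> [/\ val y != x0, depth (val y) = n.+1,
    depth (parent (val y)) = n & val (p y) = parent (val y)].
  rewrite (in_ball x0 hV) -ltnNge => yn.
  have yd : depth (val y) = n.+1.
    by apply/eqP; rewrite eqn_leq yn andbT -(in_ball x0 hV); exact: valP.
  have yx0 : val y != x0 by rewrite -(depth_eq0 x0 hV) yd.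
  have pd : depth (parent (val y)) = n.
    by move: yd; rewrite (depth_parent hV yx0) => -[].
  split=> //; rewrite /p; case: insubP => //=.
  by rewrite (in_ball x0 hV) pd leqnn.
rewrite (partition_big p (fun x => depth (val x) == n)) /=; last first.
  by move=> y /out[_ _ pd ->]; rewrite pd.
apply: eq_bigr => x /eqP xn.
have xx0 : val x != x0 by rewrite -(depth_eq0 x0 hV) xn -lt0n.
have [fin cardk] := card_succs hV xx0.
transitivity (\prod_(y : B n.+1 | val y \in fset_set (succs e x0 (val x)))
    transfer (s x)).
  apply: eq_big => y.
    rewrite in_fset_set//; apply/andP/idP; rewrite inE.
      by move=> [/out[yx0 _ _ py] /eqP <-]; apply/(succsE x0 hV); rewrite py.
    move=> /(succsE x0 hV)[yx0 py].
    have yB : val y \notin B n.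
      by rewrite (in_ball x0 hV) (depth_parent hV yx0) py xn ltnn.
    by split=> //; apply/eqP/val_inj; have [_ _ _ ->] := out _ yB.
  move=> /andP[yB /eqP pyx]; have [yx0 yd pd py] := out _ yB.
  rewrite /transfer; apply: eq_big => [j|j _]; first by rewrite (negbTE yB).
  by rewrite /H yx0 yd eqxx -py pyx ext_confE.
rewrite (big_fset_sub (fun=> transfer (s x))); last first.
  move=> y; rewrite in_fset_set// inE => /(succsE x0 hV)[yx0 py].
  by rewrite (in_ball x0 hV) (depth_parent hV yx0) py xn.
by rewrite prodr_const -cardfE cardk.
Qed.

Hypothesis zc_gt0 : forall i, 0 < zc i.

(** Each vertex of the sphere W_n produces a factor c, so weights and partition function are all
    multiplied by c^|W_n|, which cancels on normalization. *)
Lemma compatible_const (c : R) : 0 < c ->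
  (forall i, transfer i ^+ k = c * zc i) -> compatible e x0 theta z.
Proof.
move=> c0 tE n s n1.
pose N := #|[pred x : B n | depth (val x) == n]|.
have sumE (s' : {ffun B n -> spin}) :
    \sum_(t : {ffun B n.+1 -> spin} | extends t s') weight theta z t =
    c ^+ N * weight theta z s'.
  rewrite sum_extensions// weightE mulrCA; congr (_ * _).
  under eq_bigr do rewrite tE.
  by rewrite big_split /= prodr_const.
have ZE : partition_function e x0 theta z n.+1 =
    c ^+ N * partition_function e x0 theta z n.
  rewrite !partition_functionE restr_split big_distrr /=.
  by apply: eq_bigr => s' _; rewrite sumE.
under eq_bigr do rewrite finite_gibbsE.
rewrite -big_distrr /= sumE finite_gibbsE ZE invfM mulrACA mulVf ?mul1r//.
by rewrite expf_neq0// gt_eqF.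
Qed.

(** The root spin is kept separate from the spin of the first sphere because the constant
    configuration 1 is forbidden. *)
Definition star_conf (r i : spin) : {ffun B 1 -> spin} :=
  [ffun x => if val x == x0 then r else i].

Definition star_size : nat := #|[pred y : B 1 | val y != x0]|.

Lemma in_star (x : B 1) : (val x != x0) = (depth (val x) == 1%N).
Proof.
rewrite -(depth_eq0 x0 hV); move: (valP x); rewrite (in_ball x0 hV).
by case: depth => [|[]].
Qed.

Lemma star_size_gt0 : (0 < star_size)%N.
Proof.
have [_ /(_ x0) c] := hV.
have fN : finite_set [set y | e x0 y] by apply/finite_setP; exists k.+1.
have : (0 < #|` fset_set [set y | e x0 y]|)%N by rewrite (card_fset_set c).
rewrite cardfs_gt0 => /fset0Pn[y]; rewrite in_fset_set// inE /= => exy.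
have [[yx0 py]|[]] := (edgeE x0 hV _ _).1 exy; last by rewrite eqxx.
have yB : y \in B 1.
  rewrite (in_ball x0 hV) (depth_parent hV yx0) py ltnS leqn0.
  by rewrite (depth_eq0 x0 hV).
by apply/card_gt0P; exists [` yB]%fset; rewrite inE.
Qed.

Lemma star_prod (F : spin -> R) (r i : spin) :
  \prod_(x : B 1 | depth (val x) == 1%N) F (star_conf r i x) = F i ^+ star_size.
Proof.
rewrite -prodr_const; apply: eq_big => x; first by rewrite -in_star inE.
by rewrite -in_star ffunE => /negbTE ->.
Qed.

Lemma star_edge (r i : spin) : edge_weight (star_conf r i) = act r i ^+ star_size.
Proof.
rewrite -prodr_const; apply: eq_big => // y yx0.
have : depth (val y) == 1%N by rewrite -in_star.
rewrite (depth_parent hV yx0) eqSS (depth_eq0 x0 hV) => /eqP py.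
have rB : x0 \in B 1 by rewrite (in_ball x0 hV) (depth_root x0 hV).
by rewrite py (ext_confE _ [` rB]%fset) !ffunE /= eqxx (negbTE yx0).
Qed.

Lemma star_gibbs (r i : spin) :
  finite_gibbs theta z (star_conf r i) =
  (partition_function e x0 theta z 1)^-1 * (act r i * zc i) ^+ star_size.
Proof. by rewrite finite_gibbsE weightE star_edge star_prod exprMn. Qed.

Lemma star_extensions (r i : spin) :
  \sum_(t : {ffun B 2 -> spin} | extends t (star_conf r i)) finite_gibbs theta z t =
  (partition_function e x0 theta z 2)^-1 * (act r i * transfer i ^+ k) ^+ star_size.
Proof.
under eq_bigr do rewrite finite_gibbsE.
rewrite -big_distrr /= sum_extensions// star_edge.
by rewrite (star_prod (fun i => transfer i ^+ k)) exprMn.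
Qed.

Lemma transfer_gt0 (i : spin) : 0 < transfer i.
Proof.
have h j : 0 <= act i j * zc j by rewrite mulr_ge0 ?activity_ge0// ltW.
rewrite /transfer sum_spin; elim/spinP: i h => h.
- by rewrite -addrA ltr_pwDl ?addr_ge0// mulr_gt0.
- by rewrite -addrA ltr_pwDl ?addr_ge0// mulr_gt0.
- by rewrite ltr_wpDl ?addr_ge0// mulr_gt0.
Qed.

(** Consistency between the balls of radius 2 and 1 is tested on star configurations. With N
    vertices on the first sphere, it makes the N-th powers of [transfer j ^+ k] and [zc j]
    proportional, with a ratio independent of j; N-th roots of nonnegative numbers are then
    taken. *)
Lemma compatible_transfer (i : spin) : compatible e x0 theta z ->
  transfer i ^+ k * zc s2 = transfer s2 ^+ k * zc i.
Proof.
move=> comp.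
have zgt0 : forall x i, 0 < z x i by [].
set Z1 := partition_function e x0 theta z 1; set Z2 := partition_function e x0 theta z 2.
have Z10 : 0 < Z1 by exact: partition_function_gt0.
have Z20 : 0 < Z2 by exact: partition_function_gt0.
have key j : (transfer j ^+ k) ^+ star_size = Z2 / Z1 * zc j ^+ star_size.
  (* An allowed root spin makes the edge factor nonzero, so that it cancels from both sides. *)
  have [r r0] : exists r, 0 < act r j.
    by elim/spinP: j; [exists s0|exists s0|exists s2]; rewrite /activity//.
  have := comp 1%N (star_conf r j) isT; rewrite star_extensions star_gibbs !exprMn.
  rewrite -/Z1 -/Z2 mulrCA [RHS]mulrCA => /(mulfI (expf_neq0 _ (lt0r_neq0 r0))) E.
  by rewrite -mulrA -E mulrA mulfV ?mul1r// gt_eqF.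
apply: (@pexpIrn _ star_size); first exact: star_size_gt0.
- by rewrite nnegrE mulr_ge0 ?exprn_ge0 ?ltW ?transfer_gt0.
- by rewrite nnegrE mulr_ge0 ?exprn_ge0 ?ltW ?transfer_gt0.
by rewrite !exprMn !key mulrAC.
Qed.

End Constant.
End Weights.

(** * Random variables on the unit interval *)

Section UnitIntervalLaw.
Context (R : realType) d (T : measurableType d).
Variable f : measurableTypeR R -> T.
Hypothesis mf : measurable_fun setT f.

Let unit_itv_measurable : measurable (`[0, 1[%classic : set (measurableTypeR R)).
Proof. exact: measurable_itv. Qed.

Let unif := mrestr (@lebesgue_measure R) unit_itv_measurable.

HB.instance Definition _ := Measure.on unif.

Let unif_setT : unif setT = 1%E.
Proof.
by rewrite /unif /mrestr setTI lebesgue_measure_itv /= lte_fin ltr01 oppr0 adde0.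
Qed.

HB.instance Definition _ := Measure_isProbability.Build _ _ _ unif unif_setT.

HB.instance Definition _ := isMeasurableFun.Build _ _ _ _ f mf.

(** The image under [f] of Lebesgue measure restricted to [0, 1[. *)
Lemma unit_itv_law : exists mu : probability T R,
  forall A, mu A = lebesgue_measure (f @^-1` A `&` `[0, 1[).
Proof. by exists (distribution unif f) => A. Qed.

End UnitIntervalLaw.

(** * Cutting an interval into consecutive pieces of given lengths *)

Section Offset.
Variables (R : realType) (T : finType) (P : pred T) (w : T -> R).
Hypothesis w_ge0 : forall t, 0 <= w t.

(** Left endpoint of the piece of [t] when the elements of [P] are laid out in enumeration order. *)
Definition offset (t : T) : R := \sum_(t' | P t' && (enum_rank t' < enum_rank t)%N) w t'.

Lemma offset_ge0 (t : T) : 0 <= offset t.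
Proof. exact: sumr_ge0. Qed.

(** Common source of two bounds: [Q] is everything for the total length, and the elements ranked
    before a later one for disjointness. *)
Lemma offset_le_sum (t : T) (Q : pred T) : P t ->
  (forall t', P t' -> (enum_rank t' <= enum_rank t)%N -> Q t') ->
  offset t + w t <= \sum_(t' | P t' && Q t') w t'.
Proof.
move=> Pt hQ; rewrite [leRHS](bigD1 t) /=; last by rewrite Pt hQ.
rewrite [leRHS]addrC lerD2r [leRHS](bigID (fun t' => (enum_rank t' < enum_rank t)%N)) /=.
rewrite ler_wpDr ?sumr_ge0// le_eqVlt; apply/orP; left; apply/eqP; apply: eq_bigl => t'.
case Pt' : (P t') => //=; case: ltnP => // h; rewrite ?andbF// hQ ?(ltnW h)//=.
by rewrite andbT; apply/esym; apply: contraTneq h => ->; rewrite ltnn.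
Qed.

Lemma offset_le_total (t : T) : P t -> offset t + w t <= \sum_(t' | P t') w t'.
Proof.
move=> Pt; have := @offset_le_sum t predT Pt (fun _ _ _ => isT).
by under eq_bigl do rewrite andbT.
Qed.

Lemma offset_lt (t t' : T) : P t -> (enum_rank t < enum_rank t')%N ->
  offset t + w t <= offset t'.
Proof. by move=> Pt tt'; apply: offset_le_sum => // u _ /leq_ltn_trans; apply. Qed.

Lemma offset_inj (t t' : T) (v : R) : P t -> P t' ->
  offset t <= v < offset t + w t -> offset t' <= v < offset t' + w t' -> t = t'.
Proof.
move=> Pt Pt' /andP[a b] /andP[c d]; apply: enum_rank_inj; apply: val_inj.
case: (ltngtP (enum_rank t) (enum_rank t')) => // h; exfalso.
  by have := offset_lt Pt h; rewrite leNgt (le_lt_trans c b).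
by have := offset_lt Pt' h; rewrite leNgt (le_lt_trans a d).
Qed.

Lemma offset_cover (v : R) : 0 <= v < \sum_(t | P t) w t ->
  exists2 t, P t & offset t <= v < offset t + w t.
Proof.
move=> /andP[v0 v1].
pose c m : R := \sum_(t | P t && (enum_rank t < m)%N) w t.
have cT : v < c #|T|.
  rewrite /c; under eq_bigl do rewrite ltn_ord andbT.
  exact: v1.
(* The least partial sum exceeding v is not the empty one, as v >= 0; its last element is the piece
   sought. *)
have [m cm mmin] := ex_minnP (ex_intro (fun m => v < c m) _ cT).
case: m cm mmin => [|m] cm mmin.
  by move: cm; rewrite /c big_pred0 ?ltNge ?v0// => t; rewrite ltn0 andbF.
have mT : (m < #|T|)%N by exact: mmin.
have cmv : c m <= v by rewrite leNgt; apply/negP => /mmin; rewrite ltnn.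
pose t := enum_val (Ordinal mT).
have tm : enum_rank t = m :> nat by rewrite enum_valK.
have step t' : (enum_rank t' < m.+1)%N = (enum_rank t' < m)%N || (t' == t).
  rewrite ltnS leq_eqVlt orbC; congr (_ || _).
  by rewrite -tm (inj_eq val_inj) (inj_eq enum_rank_inj).
(* If that element were outside [P], adding it would not change the partial sum, against
   minimality. *)
case Pt : (P t); last first.
  move: cm; rewrite ltNge /c (eq_bigl (fun t => P t && (enum_rank t < m)%N)) ?cmv// => t'.
  by rewrite step; case: eqP => [->|]; rewrite ?orbF// Pt.
exists t => //; rewrite /offset tm cmv /=.
move: cm; rewrite /c (bigD1 t) /=; last by rewrite Pt tm ltnSn.
rewrite addrC (eq_bigl (fun t => P t && (enum_rank t < m)%N))// => t'.
rewrite step; case: eqP => [->|]; rewrite ?orbF ?andbT// orbT andbF.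
by rewrite tm ltnn andbF.
Qed.

End Offset.

(** * Nested partitions of [0, 1[ from consistent weights *)

Section NestedIntervals.
Variables (R : realType) (S : nat -> finType) (pr : forall n, S n.+1 -> S n).
Variable w : forall n, S n -> R.
Hypothesis w_ge0 : forall n s, 0 <= @w n s.
Hypothesis w_sum : forall n (s : S n), \sum_(t | pr t == s) w t = w s.
Hypothesis w_total : \sum_(s : S 0) w s = 1.

(** A cell is placed inside the cell of its restriction, after the siblings enumerated before it; by
    [w_sum] siblings exactly fill that cell. *)
Fixpoint left_end (n : nat) : S n -> R :=
  if n is m.+1 then
    fun t => left_end (pr t) + offset (fun t' => pr t' == pr t) (@w m.+1) t
  else offset predT (@w 0).

Definition cell (n : nat) (s : S n) : set R := [set` `[left_end s, left_end s + w s[].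

Lemma cell0_sub (s : S 0) (u : R) : cell s u -> 0 <= u < 1.
Proof.
rewrite /cell /= in_itv /= => /andP[a b].
rewrite (le_trans _ a) ?offset_ge0//= (lt_le_trans b)// -w_total.
exact: (@offset_le_total _ _ predT (@w 0) (@w_ge0 0) s).
Qed.

Lemma cell_sub (n : nat) (t : S n.+1) : cell t `<=` cell (pr t).
Proof.
move=> u; rewrite /cell /= !in_itv /= => /andP[a b]; apply/andP; split.
  by rewrite (le_trans _ a)// lerDl offset_ge0.
rewrite (lt_le_trans b)// -addrA lerD2l -(w_sum (pr t)).
exact: (@offset_le_total _ _ (fun t' => pr t' == pr t) (@w n.+1) (@w_ge0 n.+1)).
Qed.

Lemma cell_cover (n : nat) (s : S n) (u : R) : cell s u ->
  exists2 t, pr t = s & cell t u.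
Proof.
rewrite /cell /= in_itv /= => /andP[a b].
have [|t /eqP ts /andP[c d]] :=
  @offset_cover _ _ (fun t => pr t == s) (@w n.+1) (u - left_end s).
  by rewrite w_sum subr_ge0 a /= ltrBlDl.
by exists t => //; rewrite in_itv /= ts -lerBrDl c /= -addrA -ltrBlDl.
Qed.

Lemma cell0_cover (u : R) : 0 <= u < 1 -> exists s : S 0, cell s u.
Proof.
rewrite -w_total => h.
have [s _ hs] := @offset_cover _ _ predT (@w 0) u h.
by exists s; rewrite /cell /= in_itv.
Qed.

(** By induction on the level: the restrictions agree, and siblings have disjoint pieces. *)
Lemma cell_inj (n : nat) (s s' : S n) (u : R) : cell s u -> cell s' u -> s = s'.
Proof.
elim: n s s' => [|n IH] s s' su su'.
  move: su su'; rewrite /cell /= !in_itv /=; exact: (offset_inj (P := predT) (@w_ge0 0)).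
have prE := IH _ _ (cell_sub su) (cell_sub su').
have aux (t : S n.+1) : cell t u ->
    offset (fun t' => pr t' == pr t) (@w n.+1) t <= u - left_end (pr t)
      < offset (fun t' => pr t' == pr t) (@w n.+1) t + w t.
  by rewrite /cell /= in_itv /= lerBrDl ltrBlDl addrA.
have := aux _ su'; rewrite -prE.
apply: (offset_inj (P := fun t => pr t == pr s) (@w_ge0 n.+1) _ _ (aux _ su)).
- exact: eqxx.
- by rewrite prE.
Qed.

Lemma cell_exists (n : nat) (u : R) : 0 <= u < 1 -> exists s : S n, cell s u.
Proof.
move=> u01; elim: n => [|n [s /cell_cover[t _ tu]]]; first exact: cell0_cover.
by exists t.
Qed.

Lemma cell_sub_unit (n : nat) (s : S n) (u : R) : cell s u -> 0 <= u < 1.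
Proof.
elim: n s => [|n IH] s; first exact: cell0_sub.
by move=> /cell_sub/IH.
Qed.

(* [None] outside [0, 1[. *)
Definition sample (n : nat) (u : R) : option (S n) := [pick s | `[< cell s u >]].

Lemma sampleP (n : nat) (s : S n) (u : R) : sample n u = Some s <-> cell s u.
Proof.
rewrite /sample; case: pickP => [s' /asboolP s'u|h].
  by split=> [[<-]//|su]; congr Some; exact: cell_inj s'u su.
by split=> // su; have := h s; move/asboolP: su => ->.
Qed.

(** Cells are nested and every cell is covered by its subcells, so both levels also return [None]
    for the same u. *)
Lemma sample_pr (n : nat) (u : R) : sample n u = omap (@pr n) (sample n.+1 u).
Proof.
case E : (sample n.+1 u) => [t|] /=.
  by apply/sampleP/cell_sub/sampleP.
case E' : (sample n u) => [s|//]; move/sampleP: E' => /cell_cover[t _ /sampleP].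
by rewrite E.
Qed.

(** The set is a finite union of intervals, together with the complement of all cells when [P]
    accepts [None]. *)
Lemma sample_measurable (n : nat) (P : pred (option (S n))) :
  measurable ([set u | P (sample n u)] : set (measurableTypeR R)).
Proof.
have m1 (Q : pred (S n)) :
    measurable (\bigcup_(s in [set s | Q s]) cell s : set (measurableTypeR R)).
  apply: fin_bigcup_measurable; first exact: finite_finset.
  by move=> s _; exact: measurable_itv.
have -> : [set u | P (sample n u)] = \bigcup_(s in [set s | P (Some s)]) cell s `|`
   (if P None then ~` \bigcup_(s in [set s : S n | true]) cell s else set0).
  apply/seteqP; split=> u /=.
    case E : (sample n u) => [s|] Ps.
      by left; exists s => //; exact/sampleP.
    by right; rewrite Ps => -[s _ /sampleP]; rewrite E.
  move=> [[s Ps /sampleP -> //]|]; case: ifP => // PN h.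
  case E : (sample n u) => [s|//]; exfalso; apply: h.
  by exists s => //; exact/sampleP.
apply: measurableU; first exact: m1.
by case: ifP => // _; apply: measurableC; exact: m1.
Qed.

Lemma cell_measure (n : nat) (s : S n) :
  lebesgue_measure (cell s : set (measurableTypeR R)) = (w s)%:E.
Proof.
rewrite /cell lebesgue_measure_itv /= lte_fin ltrDl -EFinD [_ + w s]addrC addrK.
case: ltP => // h; congr EFin; apply/le_anti; rewrite h w_ge0//.
Qed.

End NestedIntervals.

(** * Splitting Gibbs measures *)

Section GibbsMeasure.
Variables (R : realType) (k : nat) (V : choiceType) (e : rel V) (x0 : V).
Hypothesis hV : cayley_tree k e.
Variable (theta : R).
Hypothesis theta_gt0 : 0 < theta.
Local Notation B := (ball_fset e x0).
Local Notation depth := (depth e x0).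

Lemma coordinate_measurable (x : V) (i : spin) :
  measurable ([set f | f x = i] : set (config V)).
Proof. by apply: sub_sigma_algebra; exists x, i. Qed.

Lemma cylinder_measurable (A : {fset V}) (s : {ffun A -> spin}) :
  measurable (cylinder s).
Proof.
rewrite (_ : cylinder s = \bigcap_(x in [set: A]) [set f : config V | f (val x) = s x]).
  apply: fin_bigcap_measurable; first exact: finite_finset.
  by move=> x _; exact: coordinate_measurable.
by apply/seteqP; split=> f /= h x => [_|]; exact: h.
Qed.

Lemma coordinate_cylinders (A : {fset V}) (x : V) (i : spin) : x \in A ->
  [set f : config V | f x = i] =
  \bigcup_(s in [set s : {ffun A -> spin} | ext_conf s x = i]) cylinder s.
Proof.
move=> xA; have xE (s : {ffun A -> spin}) : ext_conf s x = s [` xA]%fset.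
  by rewrite -ext_confE.
apply/seteqP; split=> f /=.
  by move=> fx; exists [ffun y => f (val y)] => [|y]; rewrite /= ?xE ffunE.
by move=> [s /= <- /(_ [` xA]%fset) fs]; rewrite xE -fs.
Qed.

(** Over nested domains two cylinders are nested or disjoint, which makes ball cylinders a pi-system
    up to the empty set. *)
Lemma cylinderI (A C : {fset V}) (s : {ffun A -> spin}) (t : {ffun C -> spin}) :
  {subset A <= C} ->
  cylinder s `&` cylinder t = if restr_conf A t == s then cylinder t else set0.
Proof.
move=> AC; have key f : cylinder t f -> cylinder (restr_conf A t) f.
  move=> ft x; have xC := AC _ (valP x).
  by rewrite (ft [` xC]%fset) ffunE -ext_confE.
case: eqP => [<-|ne]; apply/seteqP; split=> f //=.
- by case.
- by move=> ft; split=> //; exact: key.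
- move=> [fs ft]; apply: ne; apply/ffunP => x.
  by rewrite -(key _ ft x) fs.
Qed.

Lemma cylinder_unique (mu nu : probability (config V) R) :
  (forall n (s : {ffun B n -> spin}), (1 <= n)%N ->
    mu (cylinder s) = nu (cylinder s)) -> same_measure mu nu.
Proof.
move=> H A mA.
(* The empty set closes the family under intersection; the whole space provides the covering
   sequence for uniqueness of measures. *)
pose G : set (set (config V)) := [set C | [\/ C = set0, C = setT |
  exists n (s : {ffun B n -> spin}), (1 <= n)%N /\ C = cylinder s]].
have GI : setI_closed G.
  have GIle n m (s : {ffun B n -> spin}) (t : {ffun B m -> spin}) : (1 <= n)%N ->
      (n <= m)%N -> G (cylinder s `&` cylinder t).
    move=> n1 nm; rewrite cylinderI; last first.
      by move=> x; rewrite !(in_ball x0 hV) => /leq_trans; apply.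
    case: ifP => _; last by constructor 1.
    by constructor 3; exists m, t; split=> //; exact: leq_trans nm.
  move=> C D [->|->|[n [s [n1 ->]]]] GD; first by rewrite set0I; constructor 1.
    by rewrite setTI.
  case: GD => [->|->|[m [t [m1 ->]]]]; first by rewrite setI0; constructor 1.
    by rewrite setIT; constructor 3; exists n, s.
  have [nm|/ltnW mn] := leqP n m; first exact: GIle.
  by rewrite setIC; exact: GIle.
have mG : @measurable _ (config V) = <<s G >>.
  apply/seteqP; split.
    apply: smallest_sub; first exact: smallest_sigma_algebra.
    (* The radius is [depth x] plus one so that it is at least 1, also for the root. *)
    move=> _ [x [i ->]]; have xB : x \in B (depth x).+1 by rewrite (in_ball x0 hV).
    rewrite (coordinate_cylinders i xB).
    apply: (@fin_bigcup_measurable _ (g_sigma_algebraType G)); first exact: finite_finset.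
    move=> s _; apply: sub_sigma_algebra; constructor 3.
    by exists (depth x).+1, s.
  apply: smallest_sub; first exact: sigma_algebra_measurable.
  move=> _ [->|->|[n [s [_ ->]]]] //.
  exact: cylinder_measurable.
apply: (measure_unique G (fun=> setT)) => //.
- by move=> _; constructor 2.
- by apply/seteqP; split=> // f _; exists 0%N.
- move=> _ [->|->|[n [s [n1 ->]]]]; first by rewrite !measure0.
    exact: etrans (probability_setT mu) (esym (probability_setT nu)).
  exact: H.
- by move=> _; apply: (@le_lt_trans _ _ (mu setT)) => //; rewrite probability_setT ltry.
Qed.

Lemma splitting_gibbs_exists (z : V -> spin -> R) :
  (forall x i, 0 < z x i) -> (forall x, z x s2 = 1) -> compatible e x0 theta z ->
  exists mu : probability (config V) R, splitting_gibbs e x0 theta z mu.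
Proof.
move=> z_gt0 z2 comp.
(* Level n is the ball of radius n + 1, since consistency starts at radius 1. *)
pose S n : finType := {ffun B n.+1 -> spin}.
pose pr n (t : S n.+1) : S n := restr_conf (B n.+1) t.
pose w n (s : S n) : R := finite_gibbs theta z s.
have w_ge0 n s : 0 <= @w n s by exact: (finite_gibbs_ge0 hV theta_gt0).
have w_sum n (s : S n) : \sum_(t | @pr n t == s) @w n.+1 t = @w n s.
  rewrite -[RHS](comp n.+1 s isT); apply: eq_bigl => t.
  by rewrite extendsE//; exact: (@sub_ball _ _ _ _ hV n.+1).
have w_total : \sum_(s : S 0%N) @w 0%N s = 1 by apply: (sum_finite_gibbs x0 hV theta_gt0).
pose smp n u : option (S n) := sample pr w n u.
pose g n u x := if smp n u is Some s then ext_conf s x else s0.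
(* The spin at x is read from level [depth x], whose ball contains x; [gf] shows that any level
   whose ball contains x gives the same spin. *)
pose f (u : measurableTypeR R) : config V := fun x => g (depth x) u x.
have gS n u x : (depth x <= n.+1)%N -> g n.+1 u x = g n u x.
  move=> xn; rewrite /g /smp (sample_pr w_ge0 w_sum n).
  by case: (sample pr w n.+1 u) => //= t; rewrite restr_ext// (in_ball x0 hV).
have gf n u x : (depth x <= n.+1)%N -> g n u x = f u x.
  elim: n => [|n IH] xn; rewrite /f.
    by case: (depth x) xn (@gS 0%N u x) => [|[|//]]// _ ->.
  have [xn'|] := leqP (depth x) n.+1; first by rewrite gS// IH.
  move=> xn'; have -> : depth x = n.+2 by apply/eqP; rewrite eqn_leq xn xn'.
  by rewrite (gS n.+1).
have mf : measurable_fun setT f.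
  apply: (@measurability _ _ _ (config V) setT f
    [set C : set (V -> spin) | exists x i, C = [set f | f x = i]]) => //.
  move=> _ [_ [x [i ->]] <-]; rewrite setTI.
  pose P (o : option (S (depth x))) := (if o is Some s then ext_conf s x else s0) == i.
  have := sample_measurable w_ge0 w_sum P.
  by congr measurable; apply/seteqP; split=> u /= /eqP.
have [mu muE] := unit_itv_law mf.
exists mu; split=> // -[//|n] s _; rewrite muE.
rewrite -(cell_measure pr w_ge0 s); congr lebesgue_measure.
have cellE (t : S n) u : cell pr w t u -> forall x : B n.+1, f u (val x) = t x.
  move=> tu x; have := valP x; rewrite (in_ball x0 hV) => /(gf n u) <-.
  by rewrite /g /smp ((sampleP w_ge0 w_sum t u).2 tu) ext_confE.
(* Within [0, 1[, the configuration [f u] lies in the cylinder of s exactly when u lies in the cell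
   of s. *)
apply/seteqP; split=> u /=.
  rewrite in_itv /= => -[fs /(cell_exists w_sum w_total n)[t tu]].
  suff -> : s = t by [].
  by apply/ffunP => x; rewrite -(cellE t u tu) fs.
move=> su; split; first exact: cellE.
by rewrite in_itv /=; exact: (cell_sub_unit w_ge0 w_sum w_total su).
Qed.

End GibbsMeasure.

(** * Correspondence between solutions and translation-invariant measures *)

Section TranslationInvariant.
Variables (R : realType) (k : nat) (V : choiceType) (e : rel V) (x0 : V).
Hypotheses (k_gt0 : (0 < k)%N) (hV : cayley_tree k e).
Variable (theta : R).
Hypothesis theta_gt0 : 0 < theta.

Lemma transferE (zc : spin -> R) :
  [/\ transfer theta zc s0 = zc s0 + theta * zc s1,
      transfer theta zc s1 = theta * zc s0 + theta * zc s2 &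
      transfer theta zc s2 = theta * zc s1 + zc s2].
Proof.
by split; rewrite /transfer sum_spin /activity /= !(mul0r, mul1r, addr0, add0r).
Qed.

(** The equations say that the transfers are proportional to (x, y, 1); k-th powers are then
    proportional to the boundary law. *)
Lemma TI_solution_measure (x y : R) : TI_solution k theta x y ->
  exists mu : probability (config V) R, TISGM_of_solution k e x0 theta x y mu.
Proof.
move=> sol; have [x_gt0 y_gt0 xE yE] := sol.
pose zc : spin -> R := triple (x ^+ k) (y ^+ k) 1.
have zc_gt0 i : 0 < zc i by elim/spinP: i; rewrite /zc /triple /= ?exprn_gt0.
have [t0 t1 t2] := transferE zc.
have t2_gt0 : 0 < transfer theta zc s2 by exact: transfer_gt0.
have t2E : transfer theta zc s2 = 1 + theta * y ^+ k by rewrite t2 addrC.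
have [mu muP] : exists mu : probability (config V) R,
    splitting_gibbs e x0 theta (fun=> zc) mu; last by exists mu.
  apply: (splitting_gibbs_exists hV theta_gt0) => //.
  have t2_neq0 : 1 + theta * y ^+ k != 0 by rewrite -t2E gt_eqF.
  have t0E : transfer theta zc s0 = transfer theta zc s2 * x.
    by rewrite t0 t2E [RHS]mulrC [in RHS]xE mulfVK.
  have t1E : transfer theta zc s1 = transfer theta zc s2 * y.
    by rewrite t1 t2E [RHS]mulrC {1}yE mulfVK// mulr1.
  apply: (compatible_const hV (c := transfer theta zc s2 ^+ k)); first exact: exprn_gt0.
  by elim/spinP; [rewrite t0E exprMn|rewrite t1E exprMn|rewrite mulr1].
Qed.

Lemma TISGM_of_solution_TISGM (x y : R) (mu : probability (config V) R) :
  TISGM_of_solution k e x0 theta x y mu -> TISGM e x0 theta mu.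
Proof. by move=> [_ muP]; eexists; split; last exact: muP. Qed.

(** The ratios of transfers to [transfer s2] are the k-th roots of the entries of the law, by
    compatibility and the normalization at spin 2; the formulas for the transfers then become the
    system. *)
Lemma TISGM_solution (mu : probability (config V) R) : TISGM e x0 theta mu ->
  exists x y : R, TISGM_of_solution k e x0 theta x y mu.
Proof.
move=> [z [zc [z_gt0 z2 comp muE]]]; pose c := z x0.
have zE : z = fun=> c by apply/funext => v; exact: zc.
have c_gt0 i : 0 < c i by exact: z_gt0.
have c2 : c s2 = 1 by exact: z2.
have [t0 t1 t2] := transferE c.
have tg i : 0 < transfer theta c i by exact: transfer_gt0.
have tE i : (transfer theta c i / transfer theta c s2) ^+ k = c i.
  rewrite zE in comp; have := compatible_transfer hV theta_gt0 c_gt0 i comp.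
  rewrite c2 mulr1 expr_div_n => ->.
  by rewrite mulrAC mulfV ?mul1r// expf_neq0// gt_eqF.
exists (transfer theta c s0 / transfer theta c s2).
exists (transfer theta c s1 / transfer theta c s2).
split.
  by split; rewrite ?divr_gt0// !tE ?t0 ?t1 t2 c2 ?mulr1 [1 + _]addrC.
rewrite !tE (_ : (fun=> _) = z)//.
by rewrite zE; apply/funext => _; apply/funext; elim/spinP.
Qed.

Lemma TISGM_of_solution_unique (x y : R) (mu nu : probability (config V) R) :
  TISGM_of_solution k e x0 theta x y mu -> TISGM_of_solution k e x0 theta x y nu ->
  same_measure mu nu.
Proof.
move=> [_ [_ _ _ muE]] [_ [_ _ _ nuE]]; apply: (cylinder_unique hV (x0 := x0)) => n s n1.
exact: etrans (muE n s n1) (esym (nuE n s n1)).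
Qed.

Lemma TISGM_of_solution_inj (x y x' y' : R) (mu nu : probability (config V) R) :
  TISGM_of_solution k e x0 theta x y mu -> TISGM_of_solution k e x0 theta x' y' nu ->
  same_measure mu nu -> x = x'.
Proof.
move=> [[x_gt0 _ _ _] [z_gt0 _ _ muE]] [[x'_gt0 _ _ _] [z'_gt0 _ _ nuE]] mn.
have E r i : finite_gibbs theta (fun=> triple (x ^+ k) (y ^+ k) 1) (star_conf e x0 r i) =
    finite_gibbs theta (fun=> triple (x' ^+ k) (y' ^+ k) 1) (star_conf e x0 r i).
  apply: EFin_inj; rewrite -muE// -nuE//; apply: mn; exact: cylinder_measurable.
have act1 i : i \in [:: s0; s2] -> activity theta i i = 1.
  by rewrite !inE => /orP[] /eqP ->.
(* The all-2 star has weight 1, so the partition functions agree; the all-0 star then compares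
   powers of x^k and x'^k. *)
have := E s2 s2; have := E s0 s0; rewrite !(star_gibbs x0 hV) !act1// !mul1r.
rewrite /triple /= !expr1n !mulr1 => + Z; rewrite Z.
have Z'_gt0 := partition_function_gt0 x0 hV theta_gt0 1 z'_gt0.
move=> /(mulfI (invr_neq0 (lt0r_neq0 Z'_gt0))) h.
have xk_ge0 (u : R) : 0 < u -> 0 <= u ^+ k by move=> u0; rewrite exprn_ge0 ?ltW.
apply: (pexpIrn k_gt0); rewrite ?nnegrE ?ltW//.
by apply: (pexpIrn (star_size_gt0 x0 hV)) h; rewrite nnegrE xk_ge0.
Qed.

End TranslationInvariant.

Unset Implicit Arguments.

Theorem theorem2 (R : realType) (k : nat) (V : choiceType) (e : rel V) (x0 : V)
    (theta : R) (hk : (2 <= k)%N) (hV : cayley_tree k e) (htheta : 0 < theta) :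
  (theta_cr R k <= theta ->
     exists mu0 : probability (config V) R,
       [/\ TISGM e x0 theta mu0,
           exists y : R, TISGM_of_solution k e x0 theta 1 y mu0 &
           forall mu : probability (config V) R,
             TISGM e x0 theta mu -> same_measure mu mu0])
  /\
  (theta < theta_cr R k ->
     exists mu0 mu1 mu2 : probability (config V) R,
       [/\ [/\ TISGM e x0 theta mu0, TISGM e x0 theta mu1 & TISGM e x0 theta mu2],
           [/\ ~ same_measure mu0 mu1, ~ same_measure mu0 mu2
             & ~ same_measure mu1 mu2],
           [/\ exists y : R, TISGM_of_solution k e x0 theta 1 y mu0,
               exists x y : R, x != 1 /\ TISGM_of_solution k e x0 theta x y mu1
             & exists x y : R, x != 1 /\ TISGM_of_solution k e x0 theta x y mu2] &
           forall mu : probability (config V) R, TISGM e x0 theta mu ->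
             [\/ same_measure mu mu0, same_measure mu mu1 | same_measure mu mu2]]).
Proof.
have k_gt0 := ltnW hk.
have [y0 sol0] := TI_solution1_exists k htheta.
have [mu0 mu0P] := TI_solution_measure x0 hV htheta sol0.
split=> [cr|cr].
  exists mu0; split; [exact: TISGM_of_solution_TISGM mu0P|by exists y0|].
  move=> mu /(TISGM_solution hV htheta)[x [y muP]].
  have x1 := TI_solution_ge_cr hk htheta cr muP.1.
  rewrite x1 in muP.
  have yE := TI_solution1_unique htheta muP.1 sol0; rewrite yE in muP.
  exact: (TISGM_of_solution_unique hV muP mu0P).
have [x [y [x1 sol unq]]] := TI_solution_lt_cr hk htheta cr.
have x_gt0 : 0 < x by case: sol.
(* The first coordinates satisfy x < 1 < 1/x, which separates the three measures. *)
have xV : 1 < x^-1 by rewrite invf_gt1.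
have [mu1 mu1P] := TI_solution_measure x0 hV htheta sol.
have [mu2 mu2P] := TI_solution_measure x0 hV htheta (TI_solutionV htheta sol).
exists mu0, mu1, mu2; split.
- by split; [exact: TISGM_of_solution_TISGM mu0P|exact: TISGM_of_solution_TISGM mu1P|
    exact: TISGM_of_solution_TISGM mu2P].
- have inj := TISGM_of_solution_inj k_gt0 hV htheta.
  split=> [/(inj _ _ _ _ _ _ _ mu0P mu1P)|/(inj _ _ _ _ _ _ _ mu0P mu2P)
    |/(inj _ _ _ _ _ _ _ mu1P mu2P)] E.
  + by rewrite -E ltxx in x1.
  + by rewrite -E ltxx in xV.
  + by have := lt_trans x1 xV; rewrite -E ltxx.
- split; first by exists y0.
    by exists x, y; rewrite lt_eqF.
  by exists x^-1, (y / x); rewrite gt_eqF.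
- move=> mu /(TISGM_solution hV htheta)[x' [y' muP]].
  have [x'E|[x'E y'E]|[x'E y'E]] := unq _ _ muP.1; rewrite x'E in muP.
  + have yE := TI_solution1_unique htheta muP.1 sol0; rewrite yE in muP.
    by constructor 1; exact: (TISGM_of_solution_unique hV muP mu0P).
  + by rewrite y'E in muP; constructor 2; exact: (TISGM_of_solution_unique hV muP mu1P).
  + by rewrite y'E in muP; constructor 3; exact: (TISGM_of_solution_unique hV muP mu2P).
Qed.
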